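(* Let $s=(s_1,\ldots,s_n)$ be any sequence of positive integers. Then the $s$-derangement polynomial $d_n^s(z)$ is real-rooted, and hence log-concave and unimodal.
   Context: For a lattice $d$-simplex $\Delta=\mathrm{conv}(v^{(0)},\ldots,v^{(d)})\subset\mathbb{R}^n$, its open parallelepiped is $\Pi^\circ_\Delta=\{\sum_{i=0}^d\lambda_i(v^{(i)},1)\in\mathbb{R}^{n+1}: 0<\lambda_i<1\}$, and its local $h^\ast$-polynomial (box polynomial) is $\ell^\ast(\Delta;z)=\sum_{x\in\Pi^\circ_\Delta\cap\mathbb{Z}^{n+1}}z^{x_{n+1}}$. For a sequence of positive integers $s=(s_1,\ldots,s_n)$, the $s$-lecture hall simplex is $P_n^s=\{x\in\mathbb{R}^n: 0\le x_1/s_1\le x_2/s_2\le\cdots\le x_n/s_n\le 1\}$, and the $s$-derangement polynomial is $d_n^s(z):=\ell^\ast(P_n^s;z)$. A polynomial is real-rooted if all its zeros are real or it is identically zero. *)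

(* Defs.v *)
From HB Require Import structures.
From mathcomp Require Import all_boot all_order all_algebra algC.
From mathcomp Require Import boolp Rstruct.
Set Implicit Arguments. Unset Strict Implicit. Unset Printing Implicit Defensive.
Import Order.TTheory GRing.Theory Num.Theory.
Local Open Scope ring_scope.

(* A lattice d-simplex in R^n is given by its d+1 integer vertices
   v i : 'I_n -> int, i : 'I_d.+1. *)

Definition lift1 (n : nat) (w : 'I_n -> int) (j : 'I_n.+1) : int :=
  if unlift ord_max j is Some j' then w j' else 1.

Definition in_open_par (n d : nat) (v : 'I_d.+1 -> 'I_n -> int)
    (x : 'I_n.+1 -> int) : Prop :=
  exists lam : 'I_d.+1 -> Rdefinitions.R,
    (forall i, 0 < lam i < 1) /\
    forall j : 'I_n.+1, (x j)%:~R = \sum_(i < d.+1) lam i * (lift1 (v i) j)%:~R.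

(* A bound B such that every point of Pi°_Delta has all coordinates in (-B, B):
   |x_j| < sum_i |v^(i)_j| and 0 < x_(n+1) < d+1. *)
Definition par_bound (n d : nat) (v : 'I_d.+1 -> 'I_n -> int) : nat :=
  (\sum_(i < d.+1) \sum_(j < n) `|v i j|)%N + d.+1.

Definition grid_pt (n B : nat) (g : {ffun 'I_n.+1 -> 'I_(B.*2).+1})
    (j : 'I_n.+1) : int := (g j)%:Z - B%:Z.

(* local h^*-polynomial (box polynomial):
   sum over x in Pi°_Delta ∩ Z^(n+1) of z^(x_(n+1)).
   (x_(n+1) > 0 on Pi°_Delta, so the absolute value is harmless.) *)
Definition box_poly (n d : nat) (v : 'I_d.+1 -> 'I_n -> int) : {poly int} :=
  \sum_(g : {ffun 'I_n.+1 -> 'I_((par_bound v).*2).+1}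
          | `[< in_open_par v (grid_pt g) >])
     'X^(absz (grid_pt g ord_max)).

(* Vertices of the s-lecture hall simplex
   P_n^s = {0 <= x_1/s_1 <= ... <= x_n/s_n <= 1}:
   v^(k) = (0,...,0, s_(k+1), ..., s_n), k = 0..n (0-indexed coordinates j:
   v^(k)_j = s_j if k <= j, else 0). *)
Definition lecture_hall_vertices (n : nat) (s : 'I_n -> nat) :
    'I_n.+1 -> 'I_n -> int :=
  fun k j => if (k <= j)%N then (s j)%:Z else 0.

Definition s_derangement (n : nat) (s : 'I_n -> nat) : {poly int} :=
  box_poly (lecture_hall_vertices s).

Definition real_rooted (p : {poly int}) : Prop :=
  p = 0 \/ forall z : algC, root (map_poly intr p) z -> z \is Num.real.

Definition log_concave (p : {poly int}) : Prop :=
  forall k : nat, p`_k * p`_k.+2 <= p`_k.+1 ^+ 2.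

Definition unimodal (p : {poly int}) : Prop :=
  exists m : nat, (forall k, (k < m)%N -> p`_k <= p`_k.+1) /\
                  (forall k, (m <= k)%N -> p`_k.+1 <= p`_k).

(* Main.v *)
Require Import Defs.
From mathcomp Require Import all_boot all_order all_algebra algC.
From mathcomp Require Import boolp Rstruct ring zify.
Import Order.TTheory GRing.Theory Num.Theory.
Local Open Scope ring_scope.
Set Implicit Arguments. Unset Strict Implicit. Unset Printing Implicit Defensive.

(* Put s_(n+1) = 1.  A point of the open parallelepiped is an integer sequence
   x_1, ..., x_(n+1) whose ratios x_j / s_j increase by steps in ]0, 1[ starting
   from 0.  Writing x_j = m_j s_j + e_j, the step from (m_j, e_j) to e_(j+1) is
   forced: m_(j+1) = m_j if e_j / s_j < e_(j+1) / s_(j+1), m_(j+1) = m_j + 1 if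
   e_j / s_j > e_(j+1) / s_(j+1), and equality is excluded.  So the polynomials
   P_j(e) = sum of z^(m_j) over sequences ending with residue e satisfy a linear
   recursion with coefficients 1, z, 0, and the box polynomial is P_(n+1)(0).

   Fix z in the upper half plane.  The values P_j(e)(z), for decreasing e, turn
   counterclockwise within an angle at most arg z < pi; this pointwise form of
   interlacing is preserved by the recursion.  Vectors in such a sector cannot
   cancel, so P_j(e)(z) = 0 only if P_j(e) = 0.  Hence P_j(e) is real-rooted.

   The coefficients being nonnegative, the roots are <= 0, and multiplication by
   X + a with a >= 0 preserves the inequalities a_i a_(j+1) <= a_(i+1) a_j for
   i <= j, which imply log-concavity and unimodality. *)

(** * Orientation and sectors in the complex plane *)

(* Twice the imaginary part of x^* y: nonnegative iff y is obtained from x by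
   turning counterclockwise by an angle in [0, pi] (or one of them is 0). *)
Definition orient (C : numClosedFieldType) (x y : C) : C :=
  'i * (x * y^* - x^* * y).

Lemma orient_sum (C : numClosedFieldType) (I J : finType) (P : pred I)
    (Q : pred J) (f : I -> C) (g : J -> C) :
  (forall i j, P i -> Q j -> 0 <= orient (f i) (g j)) ->
  0 <= orient (\sum_(i | P i) f i) (\sum_(j | Q j) g j).
Proof.
move=> h.
have -> : orient (\sum_(i | P i) f i) (\sum_(j | Q j) g j) =
    \sum_(i | P i) \sum_(j | Q j) orient (f i) (g j).
  rewrite /orient !rmorph_sum /= !mulr_suml -sumrB mulr_sumr.
  apply: eq_bigr => i _.
  by rewrite !mulr_sumr -sumrB mulr_sumr.
by apply: sumr_ge0 => i Pi; apply: sumr_ge0 => j Qj; apply: h.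
Qed.

Section UpperHalfPlane.
Variables (C : numClosedFieldType) (z : C).
(** The positive quantity is twice the imaginary part of [z]. *)
Hypothesis z_up : 0 < 'i * (z^* - z).

Lemma orient_mull_self (x : C) : orient x (z * x) = x * x^* * ('i * (z^* - z)).
Proof. by rewrite /orient rmorphM; ring. Qed.

Lemma orient_mull_self_ge0 (x : C) : 0 <= orient x (z * x).
Proof. by rewrite orient_mull_self mulr_ge0 ?mul_conjC_ge0 // ltW. Qed.

(* arg x <= arg y <= arg x + arg z *)
Definition in_sector (x y : C) := 0 <= orient x y /\ 0 <= orient y (z * x).

(** With [y = - x], the bound [0 <= orient y (z * x)] makes a negative multiple of [x * x^*]
    nonnegative. *)
Lemma in_sector_add_eq0 (x y : C) :
  in_sector x y -> x + y = 0 -> x = 0.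
Proof.
case=> _ h /eqP; rewrite addrC addr_eq0 => /eqP yE.
have: orient y (z * x) = - (x * x^* * ('i * (z^* - z))).
  by rewrite yE /orient !rmorphN !rmorphM; ring.
move=> oE; move: h; rewrite oE oppr_ge0 pmulr_lle0 // => le0.
apply/eqP; rewrite -mul_conjC_eq0; apply/eqP/le_anti.
by rewrite le0 mul_conjC_ge0.
Qed.

Lemma in_sector_mul_add_eq0 (x y : C) :
  in_sector x y -> z * x + y = 0 -> x = 0 /\ y = 0.
Proof.
case=> h _ /eqP; rewrite addrC addr_eq0 => /eqP yE.
have: orient x y = - (x * x^* * ('i * (z^* - z))).
  by rewrite yE /orient !rmorphN !rmorphM; ring.
move=> oE; move: h; rewrite oE oppr_ge0 pmulr_lle0 // => le0.
have x0 : x = 0.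
  apply/eqP; rewrite -mul_conjC_eq0; apply/eqP/le_anti.
  by rewrite le0 mul_conjC_ge0.
by rewrite yE x0 mulr0 oppr0.
Qed.

Lemma in_sector_sum (I J : finType) (P : pred I) (Q : pred J)
    (f : I -> C) (g : J -> C) :
  (forall i j, P i -> Q j -> in_sector (f i) (g j)) ->
  in_sector (\sum_(i | P i) f i) (\sum_(j | Q j) g j).
Proof.
move=> h; split; first by apply: orient_sum => i j Pi Qj; case: (h i j Pi Qj).
rewrite mulr_sumr; apply: orient_sum => j i Qj Pi.
by case: (h i j Pi Qj).
Qed.

(** The nonzero term of largest index comes first in the sector and the sum of the others lies in
    its sector, so by [in_sector_add_eq0] it would be 0. *)
Lemma sum_in_sector_eq0 (m : nat) (P : pred 'I_m) (f : 'I_m -> C) :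
  (forall i j : 'I_m, (i < j)%N -> in_sector (f j) (f i)) ->
  \sum_(i | P i) f i = 0 -> forall i, P i -> f i = 0.
Proof.
move=> h s0 i Pi; apply/eqP/negPn/negP => fi0.
pose Q j := P j && (f j != 0).
have Qi : Q i by rewrite /Q Pi.
case: (@arg_maxnP _ i Q (fun j => j : nat) Qi) => k /andP[Pk fk0] kmax.
move/eqP: fk0; apply.
apply: (@in_sector_add_eq0 _ (\sum_(j | P j && (j < k)%N) f j)).
  rewrite -[f k](big_pred1_eq +%R k f); apply: in_sector_sum => i' j /eqP -> /andP[_].
  exact: h.
rewrite -[RHS]s0 [RHS](bigD1 k) //=; congr (_ + _).
rewrite [RHS](bigID (fun j : 'I_m => (j < k)%N)) /=.
rewrite [X in _ = _ + X]big1 ?addr0.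
  apply: eq_bigl => j; rewrite -andbA; case: ltngtP => //=; rewrite ?andbF //.
  by move=> /ltn_eqF; rewrite -val_eqE /= => ->.
move=> j /andP[/andP[Pj jk]]; rewrite -leqNgt => kj.
apply/eqP/negPn/negP => fj0; have := kmax j; rewrite /Q Pj fj0 => /(_ isT) /= jk'.
have {}jk' : (j <= k)%N by exact: jk'.
by case/negP: jk; rewrite -val_eqE eqn_leq kj jk'.
Qed.

(* Two rows of the recursion, indexed by e' > e, see the residues c split into
   five blocks X, Y, M, W, V by comparing c / s_j with e' / s_(j+1) and
   e / s_(j+1), in decreasing order of c; the conclusion expands bilinearly. *)
Lemma in_sector_blocks (X Y M W V : C) :
  in_sector X Y -> in_sector X M -> in_sector X W -> in_sector X V ->
  in_sector Y M -> in_sector Y W -> in_sector Y V ->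
  in_sector M W -> in_sector M V -> in_sector W V ->
  in_sector (z * X + M + W + V) (z * X + z * Y + z * M + V).
Proof.
move=> [xy1 xy2] [xm1 xm2] [xw1 xw2] [xv1 xv2] [ym1 ym2] [yw1 yw2] [yv1 yv2].
move=> [mw1 mw2] [mv1 mv2] [wv1 wv2].
have n0 : 0 <= z * z^* by apply: mul_conjC_ge0.
split.
  (* The term [orient (z * X) V] is nonpositive, but it cancels against [orient V (z * X)]. *)
  have -> : orient (z * X + M + W + V) (z * X + z * Y + z * M + V) =
    z * z^* * (orient X Y + orient X M) + orient M (z * X) +
    orient M (z * M) + orient M V + orient W (z * X)  + orient W (z * Y) +
    orient W (z * M) + orient W V + orient V (z * Y) + orient V (z * M)
    + orient M (z * Y).
    by rewrite /orient !rmorphD !rmorphM; ring.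
  by repeat first [assumption | exact: orient_mull_self_ge0
                   | apply: addr_ge0 | apply: mulr_ge0].
(* The hypotheses do not settle the sign of [orient V (z * (z * X))]; it is absorbed in the
   self-orientation of [z * X + V]. *)
have -> : orient (z * X + z * Y + z * M + V) (z * (z * X + M + W + V)) =
  orient (z * X + V) (z * (z * X + V)) +
  z * z^* * (orient X M + orient X W + orient Y (z * X) + orient Y M +
   orient Y W + orient Y V + orient M (z * X) + orient M W + orient M V) +
  orient V (z * M) + orient V (z * W).
  by rewrite /orient !rmorphM !rmorphD !rmorphM; ring.
by repeat first [assumption | exact: orient_mull_self_ge0
                   | apply: addr_ge0 | apply: mulr_ge0].
Qed.
End UpperHalfPlane.

(** * The recursion and its real-rootedness *)

Definition step_weight (R : nzRingType) (z : R) (a b : nat) : R :=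
  if (a < b)%N then 1 else if (b < a)%N then z else 0.

(* P_j(e), with j shifted so that S 0 plays the role of s_1. *)
Fixpoint frac_poly (S : nat -> nat) (j e : nat) : {poly int} :=
  if j is j'.+1 then
    \sum_(c < S j') step_weight 'X (c * S j'.+1) (e * S j') * frac_poly S j' c
  else (0 < e)%N%:R.

Definition frac_val (C : numClosedFieldType) (S : nat -> nat) (z : C)
  (j e : nat) : C := (map_poly intr (frac_poly S j e)).[z].

Lemma frac_val0 (C : numClosedFieldType) (S : nat -> nat) (z : C) (e : nat) :
  frac_val S z 0 e = (0 < e)%N%:R.
Proof. by rewrite /frac_val /= rmorph_nat hornerMn hornerC. Qed.

Lemma frac_valS (C : numClosedFieldType) (S : nat -> nat) (z : C) (j e : nat) :
  frac_val S z j.+1 e =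
  \sum_(c < S j) step_weight z (c * S j.+1) (e * S j) * frac_val S z j c.
Proof.
rewrite /frac_val /= rmorph_sum /= horner_sum; apply: eq_bigr => c _.
rewrite rmorphM hornerM /step_weight; congr (_ * _).
case: ifP => _; first by rewrite rmorph1 hornerC.
by case: ifP => _ /=; rewrite ?map_polyX ?hornerX // map_poly0 horner0.
Qed.

(** The second claim rests on the first one level below: if the value at [j.+1] is 0, the sector
    forces every term of nonzero weight to vanish, and by induction the corresponding polynomials
    are 0. *)
Lemma frac_val_sector (C : numClosedFieldType) (S : nat -> nat) (z : C) :
  0 < 'i * (z^* - z) -> (forall j, 0 < S j)%N -> forall j,
  (forall e e', (e < e')%N -> (e' < S j)%N ->
    in_sector z (frac_val S z j e') (frac_val S z j e)) /\
  (forall e, frac_val S z j e = 0 -> frac_poly S j e = 0).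
Proof.
move=> z_up S_gt0; elim=> [|j [IHs IH0]].
  split=> [e e' lt_ee' _|[|e]]; rewrite !frac_val0 //; last first.
    by move/eqP; rewrite oner_eq0.
  rewrite (leq_ltn_trans _ lt_ee') //.
  case: e {lt_ee'} => [|e]; rewrite /= ?mulr0n mulr1n; split.
  - by rewrite /orient !(conjC0, mulr0, mul0r, subrr).
  - by rewrite /orient !(conjC0, mulr0, mul0r, subrr).
  - by rewrite /orient mul1r mulr1 subrr mulr0.
  - exact: orient_mull_self_ge0.
set f := fun c : 'I_(S j) => frac_val S z j c.
split=> [e e' lt_ee' _|e].
  pose b := (e * S j)%N; pose b' := (e' * S j)%N.
  pose a (c : 'I_(S j)) := (c * S j.+1)%N.
  have bb' : (b < b')%N by rewrite ltn_pmul2r.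
  have sec (P Q : pred 'I_(S j)) : (forall i k, P i -> Q k -> (a k < a i)%N) ->
      in_sector z (\sum_(i | P i) f i) (\sum_(i | Q i) f i).
    move=> PQ; apply: in_sector_sum => i k Pi Qk; apply: IHs => //.
    by have := PQ i k Pi Qk; rewrite ltn_pmul2r.
  (* The block [Y], where [a i == b'], has weight 0 in this row; in the row of [e] it is [W], where
     [a i == b], that drops out. *)
  have -> : frac_val S z j.+1 e' =
      z * (\sum_(i | (b' < a i)%N) f i) + \sum_(i | (b < a i < b')%N) f i
      + \sum_(i | a i == b) f i + \sum_(i | (a i < b)%N) f i.
    rewrite frac_valS mulr_sumr !(big_mkcond (fun i => _ < _)%N).
    rewrite (big_mkcond (fun i => a i == b)).
    rewrite (big_mkcond (fun i => _ < _ < _)%N) -!big_split; apply: eq_bigr => c _ /=.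
    rewrite /step_weight -/(a c) -/b' -/(f c).
    case: (ltngtP (a c) b'); case: (ltngtP (a c) b) => ? ?; try lia;
      by rewrite /= !(mul1r, mul0r, addr0, add0r).
  have -> : frac_val S z j.+1 e =
      z * (\sum_(i | (b' < a i)%N) f i) + z * (\sum_(i | a i == b') f i)
      + z * (\sum_(i | (b < a i < b')%N) f i) + \sum_(i | (a i < b)%N) f i.
    rewrite frac_valS !mulr_sumr !(big_mkcond (fun i => _ < _)%N).
    rewrite (big_mkcond (fun i => a i == b')).
    rewrite (big_mkcond (fun i => _ < _ < _)%N) -!big_split; apply: eq_bigr => c _ /=.
    rewrite /step_weight -/(a c) -/b -/(f c).
    case: (ltngtP (a c) b'); case: (ltngtP (a c) b) => ? ?; try lia;
      by rewrite /= !(mul1r, mul0r, addr0, add0r).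
  by apply: in_sector_blocks => //; apply: sec => i k; lia.
pose b := (e * S j)%N; pose a (c : 'I_(S j)) := (c * S j.+1)%N.
have -> : frac_val S z j.+1 e =
    z * (\sum_(i | (b < a i)%N) f i) + \sum_(i | (a i < b)%N) f i.
  rewrite frac_valS !mulr_sumr !(big_mkcond (fun i => _ < _)%N).
  rewrite -!big_split; apply: eq_bigr => c _ /=.
  rewrite /step_weight -/(a c) -/b -/(f c).
  by case: (ltngtP (a c) b) => _; rewrite /= !(mul1r, mul0r, addr0, add0r).
have fsec (i k : 'I_(S j)) : (i < k)%N -> in_sector z (f k) (f i).
  by move=> ik; apply: IHs.
case/in_sector_mul_add_eq0 => //.
  apply: in_sector_sum => i k bi kb; apply: fsec.
  by have := ltn_trans kb bi; rewrite ltn_pmul2r.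
move=> /(sum_in_sector_eq0 z_up fsec) gt0 /(sum_in_sector_eq0 z_up fsec) lt0.
rewrite /= big1 // => c _; rewrite /step_weight -/(a c) -/b.
case: ltngtP => [cb|cb|_]; last by rewrite mul0r.
  by rewrite (IH0 _ (lt0 c cb)) mulr0.
by rewrite (IH0 _ (gt0 c cb)) mulr0.
Qed.

(** The coefficients are integers, so a root in the lower half plane has its conjugate, in the upper
    half plane, as a root too. *)
Lemma frac_poly_real_rooted (S : nat -> nat) (j e : nat) :
  (forall j, 0 < S j)%N -> real_rooted (frac_poly S j e).
Proof.
move=> S_gt0; have [-> |p0] := eqVneq (frac_poly S j e) 0; [by left|right].
have up (z : algC) : 0 < 'i * (z^* - z) -> ~~ root (map_poly intr (frac_poly S j e)) z.
  move=> z_up; apply/negP => /eqP pz; have [_ h] := frac_val_sector z_up S_gt0 j.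
  by move: p0; rewrite (h e pz) eqxx.
move=> z pz; apply/Creal_ImP/eqP/negPn/negP => Im0.
have ImR : 'i * (z^* - z) \is Num.real.
  by rewrite -[_ * _](@divfK _ 2) ?pnatr_eq0 // -ImE realM ?Creal_Im.
have: 'i * (z^* - z) != 0.
  by apply: contra Im0 => /eqP h; rewrite ImE h mul0r.
rewrite real_neqr_lt ?real0 // => /orP[lt0|/up/negP//].
have /up/negP : 0 < 'i * (z^*^* - z^*) by rewrite conjCK -opprB mulrN oppr_gt0.
apply.
have -> : map_poly intr (frac_poly S j e) =
    map_poly Num.conj (map_poly intr (frac_poly S j e) : {poly algC}).
  by apply/polyP => i; rewrite !coef_map /= rmorph_int.
by rewrite /root horner_map (eqP pz) rmorph0.
Qed.

(** * From real roots to log-concavity and unimodality *)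

(* Stronger than log-concavity: excludes internal zeros. *)
Definition pf2 (R : numDomainType) (p : {poly R}) : Prop :=
  (forall k, 0 <= p`_k) /\
  forall i j, (i <= j)%N -> p`_i * p`_j.+1 <= p`_i.+1 * p`_j.

Lemma pf2_mulXaddC (R : numDomainType) (p : {poly R}) (a : R) :
  0 <= a -> pf2 p -> pf2 (('X + a%:P) * p).
Proof.
move=> a0 [p0 plc].
have cS k : (('X + a%:P) * p)`_k.+1 = p`_k + a * p`_k.+1.
  by rewrite mulrDl coefD coefXM coefCM.
have c0 : (('X + a%:P) * p)`_0 = a * p`_0.
  by rewrite mulrDl coefD coefXM coefCM add0r.
split=> [[|k]|i j ij]; first by rewrite c0 mulr_ge0.
  by rewrite cS addr_ge0 ?mulr_ge0.
(* Off the diagonal [i < j], so the inequality of [p] may be used with [i] raised by one. *)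
have [->|ne_ij] := eqVneq i j; first by rewrite mulrC.
case: j ij ne_ij => [|j] ij ne_ij; first by move/eqP: ne_ij => ?; lia.
have {}ij : (i <= j)%N by move/eqP: ne_ij => ?; lia.
case: i ij ne_ij => [|i] ij ne_ij; rewrite ?c0 !cS -subr_ge0.
  have -> : (p`_0 + a * p`_1) * (p`_j + a * p`_j.+1)
      - a * p`_0 * (p`_j.+1 + a * p`_j.+2)
    = p`_0 * p`_j + a * (p`_1 * p`_j)
      + a * a * (p`_1 * p`_j.+1 - p`_0 * p`_j.+2) by ring.
  by repeat first [exact: p0 | exact: a0 | by rewrite subr_ge0 plc //; lia
                  | apply: addr_ge0 | apply: mulr_ge0].
(* Sorted by powers of [a]; the product of the coefficients [i.+1] and [j.+1] is inserted twice with
   opposite signs, so that each difference is an instance of [plc]. *)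
have -> : (p`_i.+1 + a * p`_i.+2) * (p`_j + a * p`_j.+1)
    - (p`_i + a * p`_i.+1) * (p`_j.+1 + a * p`_j.+2)
  = (p`_i.+1 * p`_j - p`_i * p`_j.+1)
    + a * ((p`_i.+2 * p`_j - p`_i.+1 * p`_j.+1) + (p`_i.+1 * p`_j.+1 - p`_i * p`_j.+2))
    + a * a * (p`_i.+2 * p`_j.+1 - p`_i.+1 * p`_j.+2) by ring.
by repeat first [exact: p0 | exact: a0 | by rewrite subr_ge0 plc //; lia
                  | apply: addr_ge0 | apply: mulr_ge0].
Qed.

Lemma pf2_real_rooted (p : {poly int}) :
  (forall k, 0 <= p`_k) -> real_rooted p -> pf2 p.
Proof.
move=> p_ge0 rp; have [->|p_neq0] := eqVneq p 0.
  by split=> *; rewrite !coef0 ?mul0r.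
case: rp => [pE|rp]; first by rewrite pE eqxx in p_neq0.
pose q : {poly algC} := map_poly intr p.
have q_ge0 k : 0 <= q`_k by rewrite coef_map /= ler0z.
have [r qE] := closed_field_poly_normal q.
have q0 : q != 0 by rewrite map_poly_eq0_id0 ?intr_eq0 // lead_coef_eq0.
have r_le0 : {in r, forall x, x <= 0}.
  move=> x xr; have rx : root q x.
    by rewrite qE rootZ ?root_prod_XsubC // lead_coef_eq0.
  have := rp x rx; rewrite realE => /orP[x0|//].
  (* At a root [x >= 0] all terms are nonnegative, so the leading one vanishes and [x = 0]. *)
  have /psumr_eq0P : \sum_(i < size q) q`_i * x ^+ i = 0.
    by rewrite -horner_coef; apply/eqP.
  have kq : ((size q).-1 < size q)%N by rewrite prednK // size_poly_gt0.
  move=> /(_ (fun i _ => mulr_ge0 (q_ge0 i) (exprn_ge0 i x0)) (Ordinal kq) isT) /eqP.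
  by rewrite mulf_eq0 lead_coef_eq0 (negPf q0) expf_eq0 => /andP[_ /eqP ->].
suff qlc : pf2 q.
  split=> // i j ij; case: qlc => _ /(_ i j ij).
  by rewrite !coef_map /= -!rmorphM /= ler_int.
rewrite qE.
have : 0 <= lead_coef q by apply: q_ge0.
elim: r r_le0 {qE} => [|x r IH] r0 c0.
  rewrite big_nil alg_polyC; split=> [k|i j _]; first by rewrite coefC; case: ifP.
  by rewrite !coefC /= mul0r mulr0.
rewrite big_cons scalerAr -polyCN; apply: pf2_mulXaddC.
  by rewrite oppr_ge0 r0 ?mem_head.
by apply: IH => // y yr; apply: r0; rewrite inE yr orbT.
Qed.

Lemma pf2_log_concave (p : {poly int}) : pf2 p -> log_concave p.
Proof. by case=> _ h k; rewrite expr2 h. Qed.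

(** The peak [m] is the first strict descent. For [k >= m], [plc] bounds the product of coefficients
    [m] and [k.+1] by that of [m.+1] and [k], and dividing by the positive coefficient [m]
    propagates the descent. *)
Lemma pf2_unimodal (p : {poly int}) : pf2 p -> unimodal p.
Proof.
case=> p_ge0 plc.
have [->|p0] := eqVneq p 0; first by exists 0%N; split=> k; rewrite !coef0.
have ex : exists k, p`_k.+1 < p`_k.
  exists (size p).-1; rewrite [_.+1]prednK ?size_poly_gt0 // nth_default //.
  by rewrite lt_neqAle p_ge0 eq_sym lead_coef_eq0 p0.
case: (ex_minnP ex) => m lt_m min_m; exists m; split=> k km.
  by rewrite leNgt; apply/negP => /min_m; rewrite leqNgt km.
have pm_gt0 : 0 < p`_m by apply: le_lt_trans lt_m.
rewrite -(ler_pM2l pm_gt0) (le_trans (plc _ _ km)) // ler_wpM2r //.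
exact: ltW.
Qed.

(** * Counting chains by their last entry *)

Definition link (S : nat -> nat) (j : nat) (x y : int) : bool :=
  0 < y * (S j)%:Z - x * (S j.+1)%:Z < (S j * S j.+1)%N%:Z.

(* 0 < x_0 / S_0 < 1 and 0 < x_(j+1) / S_(j+1) - x_j / S_j < 1. *)
Fixpoint chain (S : nat -> nat) (x : nat -> int) (n : nat) : bool :=
  if n is m.+1 then chain S x m && link S m (x m) (x m.+1)
  else 0 < x 0%N < (S 0%N)%:Z.

Lemma eq_chain (S : nat -> nat) (x y : nat -> int) (n : nat) :
  (forall k, (k <= n)%N -> x k = y k) -> chain S x n = chain S y n.
Proof.
elim: n => [|n IH] xy /=; first by rewrite xy.
by rewrite IH ?xy // => k kn; apply: xy; apply: leqW.
Qed.

Lemma chainP (S : nat -> nat) (x : nat -> int) (n : nat) :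
  reflect (0 < x 0%N < (S 0%N)%:Z /\
           forall k, (k < n)%N -> link S k (x k) (x k.+1)) (chain S x n).
Proof.
elim: n => [|n IH] /=; first by apply: (iffP idP) => [|[]].
apply: (iffP andP) => [[/IH[x0 xs] xn]|[x0 xs]].
  split=> // k; rewrite ltnS leq_eqVlt => /orP[/eqP->//|]; exact: xs.
by split; [apply/IH; split=> // k kn; apply: xs; apply: leqW | apply: xs].
Qed.

(** [T] with [v] models a finite window of integers; fixing the last entry makes the count
    recursive. *)
Fixpoint chain_count (T : finType) (v : T -> int) (S : nat -> nat) (n : nat)
    (t : T) : nat :=
  if n is m.+1 then \sum_(u | link S m (v u) (v t)) chain_count v S m u
  else (0 < v t < (S 0%N)%:Z)%R.

Definition ffun_snoc (T : Type) (n : nat) (h : {ffun 'I_n -> T}) (t : T) :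
    {ffun 'I_n.+1 -> T} :=
  [ffun i => if unlift ord_max i is Some k then h k else t].

Lemma ffun_snoc_lift (T : Type) (n : nat) (h : {ffun 'I_n -> T}) (t : T) (i : 'I_n) :
  ffun_snoc h t (lift ord_max i) = h i.
Proof. by rewrite ffunE liftK. Qed.

Lemma ffun_snoc_max (T : Type) (n : nat) (h : {ffun 'I_n -> T}) (t : T) :
  ffun_snoc h t ord_max = t.
Proof. by rewrite ffunE unlift_none. Qed.

Lemma ffun_snoc_bij (T : Type) (n : nat) :
  bijective (fun p : {ffun 'I_n -> T} * T => ffun_snoc p.1 p.2).
Proof.
exists (fun g : {ffun 'I_n.+1 -> T} => ([ffun i => g (lift ord_max i)], g ord_max)).
  move=> [h t]; rewrite ffun_snoc_max; congr (_, _).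
  by apply/ffunP => i; rewrite ffunE ffun_snoc_lift.
move=> g; apply/ffunP => i; rewrite ffunE /=.
by case: unliftP => [k|] ->; rewrite ?ffunE.
Qed.

(** Transfer-matrix argument: [F] is arbitrary so that, once the last entry is split off, the link
    to it can be absorbed into the function of the previous entry. *)
Lemma sum_chain (T : finType) (v : T -> int) (S : nat -> nat) (M : nmodType)
    (F : T -> M) (n : nat) :
  \sum_(g : {ffun 'I_n.+1 -> T} | chain S (fun k => v (g (inord k))) n)
    F (g ord_max) = \sum_t F t *+ chain_count v S n t.
Proof.
elim: n F => [|n IH] F.
  rewrite (reindex (fun t : T => [ffun => t] : {ffun 'I_1 -> T})) /=; last first.
    exists (fun g : {ffun 'I_1 -> T} => g ord0) => [t _|g _]; first by rewrite ffunE.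
    by apply/ffunP => i; rewrite ffunE; congr (g _); exact/esym/ord1.
  rewrite big_mkcond; apply: eq_bigr => t _; rewrite !ffunE.
  by case: ifP.
rewrite (reindex _ (onW_bij _ (@ffun_snoc_bij T n.+1))) /=.
transitivity (\sum_t \sum_(h : {ffun 'I_n.+1 -> T}
                          | chain S (fun k => v (h (inord k))) n)
     (if link S n (v (h ord_max)) (v t) then F t else 0)).
  rewrite exchange_big pair_big_dep /= big_mkcond [RHS]big_mkcond.
  apply: eq_bigr => -[h t] _ /=; rewrite andbT ffun_snoc_max.
  have snoc_lt k : (k <= n)%N -> ffun_snoc h t (inord k) = h (inord k).
    move=> kn; rewrite (_ : inord k = lift ord_max (inord k)) ?ffun_snoc_lift //.
    by apply: ord_inj; rewrite lift_max !inordK // ltnS leqW.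
  rewrite (@eq_chain _ _ (fun k => v (h (inord k)))) => [|k kn]; last first.
    by rewrite snoc_lt.
  rewrite snoc_lt // -[inord n.+1](_ : ord_max = _) ?ffun_snoc_max; last first.
    by apply: ord_inj; rewrite inordK.
  rewrite -[inord n](_ : ord_max = _); last by apply: ord_inj; rewrite inordK.
  by case: (chain _ _ _); case: link.
apply: eq_bigr => t _; rewrite (IH (fun u => if link S n (v u) (v t) then F t else 0)).
rewrite -sumrMnr [RHS]big_mkcond; apply: eq_bigr => u _ /=.
by case: ifP; rewrite // mul0rn.
Qed.

(** Each of the [n.+1] steps raises the ratio, starting from 0, by less than 1. *)
Lemma chain_count_bound (T : finType) (v : T -> int) (S : nat -> nat) (n : nat)
    (t : T) :
  (forall j, 0 < S j)%N -> (0 < chain_count v S n t)%N ->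
  exists2 a : nat, v t = a%:Z & (a < n.+1 * S n)%N.
Proof.
move=> S_gt0; elim: n t => [|n IH] t /=.
  by case: (v t) => // a; rewrite lt0b => /andP[_ aS]; exists a => //; rewrite mul1n.
rewrite lt0n sum_nat_eq0 negb_forall => /existsP[u]; rewrite negb_imply -lt0n.
move=> /andP[/andP[l1 l2] /IH[a uE aS]]; rewrite uE in l1 l2.
have [Sn Sn1] := (S_gt0 n, S_gt0 n.+1).
have t_gt0 : 0 < v t.
  rewrite -(pmulr_lgt0 _ (_ : 0 < (S n)%:Z)) //.
  by move: l1; rewrite subr_gt0; apply: le_lt_trans.
case: (v t) t_gt0 l1 l2 => // b _ l1 l2; exists b => //.
rewrite -(ltn_pmul2r Sn).
have : (a * S n.+1 < n.+1 * S n * S n.+1)%N by rewrite ltn_pmul2r.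
by move: l2; rewrite !mulSn mulnDl; nia.
Qed.

(** Dividing by [p * q] gives [0 < (m' - m) + (e/q - c/p) < 1], where the fractional parts differ by
    less than 1. *)
Lemma link_residues (p q m m' c e : nat) : (c < p)%N -> (e < q)%N ->
  ((m * p + c) * q < (m' * q + e) * p < (m * p + c) * q + p * q)%N =
  (c * q < e * p)%N && (m' == m) || (e * p < c * q)%N && (m' == m.+1).
Proof.
move=> cp eq_lt.
have c1 : (c * q < p * q)%N by rewrite ltn_pmul2r //; lia.
have e1 : (e * p < p * q)%N by rewrite mulnC ltn_pmul2l //; lia.
rewrite !mulnDl -!mulnA [(q * p)%N]mulnC.
move: (c * q)%N (e * p)%N (p * q)%N c1 e1 => x y K xK yK.
case: (ltngtP m' m) => [lt|gt|->]; last by lia.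
  have : (m' * K + K <= m * K)%N by rewrite -mulSnr leq_mul2r lt orbT.
  by lia.
case: (ltngtP m' m.+1) => [|lt|->]; [by lia| |by rewrite mulSn; lia].
have : (m * K + K + K <= m' * K)%N by rewrite -!mulSnr leq_mul2r lt orbT.
by lia.
Qed.

Lemma linkE (S : nat -> nat) (j a b : nat) :
  link S j a%:Z b%:Z =
  (a * S j.+1 < b * S j < a * S j.+1 + S j * S j.+1)%N.
Proof. by rewrite /link; lia. Qed.

Lemma link_ge0 (S : nat -> nat) (j a : nat) (y : int) :
  (0 < S j)%N -> link S j a%:Z y -> exists b : nat, y = b%:Z.
Proof.
move=> Sj /andP[y_gt _]; case: y y_gt => [b _|b]; first by exists b.
rewrite NegzE; nia.
Qed.

(** The covering hypothesis and injectivity ensure that each value forced by the recursion is taken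
    at exactly one index. *)
Lemma chain_count_fracE (T : finType) (v : T -> int) (S : nat -> nat) (n e : nat) :
  injective v -> (forall j, 0 < S j)%N ->
  (forall j a, (j <= n)%N -> (a < j.+1 * S j)%N -> exists t, v t = a%:Z) ->
  (e < S n)%N ->
  \sum_(t | (`|v t| %% S n == e)%N) 'X^(`|v t| %/ S n)%N *+ chain_count v S n t =
  frac_poly S n e.
Proof.
move=> v_inj S_gt0; elim: n e => [|n IH] e cov eS /=.
  have [t tE] : exists t, v t = e%:Z by apply: (cov 0%N); rewrite ?mul1n.
  rewrite (bigD1 t) /= ?tE ?modn_small // big1 => [|u /andP[ue ut]].
    by rewrite addr0 divn_small // ltz_nat eS andbT.
  case: (boolP (0 < v u < (S 0%N)%:Z)) => //.
  case uE: (v u) ue => [a|//] ue /andP[_ aS]; case/negP: ut; apply/eqP/v_inj.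
  by rewrite uE tE -(eqP ue) modn_small.
have covn : forall j a, (j <= n)%N -> (a < j.+1 * S j)%N -> exists t, v t = a%:Z.
  by move=> j a jn; apply: cov; apply: leqW.
transitivity (\sum_u step_weight 'X ((`|v u| %% S n) * S n.+1) (e * S n) *
                'X^(`|v u| %/ S n)%N *+ chain_count v S n u : {poly int}).
  transitivity (\sum_u (\sum_(t | (`|v t| %% S n.+1 == e)%N && link S n (v u) (v t))
                  'X^(`|v t| %/ S n.+1)%N) *+ chain_count v S n u : {poly int}).
    under eq_bigr do rewrite -sumrMnr.
    rewrite (exchange_big_dep xpredT) //=; apply: eq_bigr => u _.
    by rewrite -sumrMnl.
  (* When some chain ends at [u], the bound on [v u] keeps its quotient at most [n], so the next
     quotient is at most [n.+1] and stays covered. *)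
  apply: eq_bigr => u _; have [->|] := posnP (chain_count v S n u).
    by rewrite !mulr0n.
  move=> /(chain_count_bound S_gt0)[a uE a_lt]; congr (_ *+ _); rewrite uE absz_nat.
  have mod_lt := ltn_pmod a (S_gt0 n).
  have linkP t m : v t = (m * S n.+1 + e)%N%:Z ->
      link S n a%:Z (v t) = ((a %% S n) * S n.+1 < e * S n)%N && (m == a %/ S n)%N
        || (e * S n < (a %% S n) * S n.+1)%N && (m == (a %/ S n).+1).
    by move=> ->; rewrite linkE {1 2}(divn_eq a (S n)) link_residues.
  have tE t : (`|v t| %% S n.+1 == e)%N && link S n a%:Z (v t) ->
      v t = (`|v t| %/ S n.+1 * S n.+1 + e)%N%:Z.
    by case/andP=> /eqP te /(link_ge0 (S_gt0 n))[b tb]; rewrite -te -divn_eq tb.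
  have le_div : (a %/ S n <= n)%N by rewrite -ltnS ltn_divLR.
  (* The next entry is determined by its residue [e] and its forced quotient [m], so the inner sum
     has one term. *)
  have single m : (m <= n.+1)%N ->
      (forall m', ((a %% S n) * S n.+1 < e * S n)%N && (m' == a %/ S n)%N
        || (e * S n < (a %% S n) * S n.+1)%N && (m' == (a %/ S n).+1) = (m' == m)) ->
      \sum_(t | (`|v t| %% S n.+1 == e)%N && link S n a%:Z (v t))
         'X^(`|v t| %/ S n.+1)%N = 'X^m :> {poly int}.
    move=> mn mP.
    have [t0 t0E] : exists t, v t = (m * S n.+1 + e)%N%:Z.
      apply: (cov n.+1) => //.
      rewrite (leq_trans (n := m.+1 * S n.+1)) ?leq_mul2r ?ltnS ?mn ?orbT //.
      by rewrite mulSn addnC ltn_add2r.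
    rewrite (big_pred1 t0) => [|t].
      by rewrite t0E absz_nat divnMDl // divn_small // addn0.
    apply/idP/eqP => [tP|->]; last first.
      by rewrite (linkP _ _ t0E) mP eqxx t0E absz_nat modnMDl modn_small // eqxx.
    apply: v_inj; have := tE t tP; case/andP: tP => _ lt.
    by move=> {}tE; rewrite (linkP _ _ tE) mP in lt; rewrite tE (eqP lt) t0E.
  rewrite /step_weight; case: ltngtP => cmp.
  - rewrite (single (a %/ S n)%N) ?mul1r // ?leqW // => m'.
    by rewrite cmp (ltnNge (e * _)) ltnW //= orbF.
  - rewrite (single (a %/ S n).+1) ?exprS // => m'.
    by rewrite cmp (ltnNge (_ * S n.+1)) ltnW.
  - rewrite mul0r big_pred0 // => t; apply/negP => tP.
    by have := linkP _ _ (tE t tP); case/andP: tP => _ ->; rewrite cmp !ltnn.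
rewrite (partition_big (fun u => Ordinal (ltn_pmod `|v u|%N (S_gt0 n))) xpredT) //=.
apply: eq_bigr => c _; rewrite -IH // mulr_sumr.
by apply: eq_big => u; rewrite -val_eqE //= => /eqP ->; rewrite mulrnAr.
Qed.

(** * The open parallelepiped as a set of chains *)

(** Coordinate [j] of the point is [S j] times the sum of the [lam i] with [i <= j], so [lam] is the
    sequence of increments of the ratios [T]. *)
Lemma in_open_parP (n : nat) (s : 'I_n -> nat) (S : nat -> nat) (x : 'I_n.+1 -> int) :
  (forall j, 0 < S j)%N -> (forall j : 'I_n, S j = s j) -> S n = 1%N ->
  in_open_par (lecture_hall_vertices s) x <->
  chain S (fun k => x (inord k)) n.
Proof.
move=> S_gt0 Ss Sn; set y := fun k => x (inord k).
have S0 j : ((S j)%:Z%:~R : Rdefinitions.R) != 0 by rewrite intr_eq0 eqz_nat -lt0n.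
have liftE (i j : 'I_n.+1) : lift1 (lecture_hall_vertices s i) j =
    if (i <= j)%N then (S j)%:Z else 0.
  rewrite /lift1; case: unliftP => [k|] ->.
    by rewrite /lecture_hall_vertices lift_max Ss.
  by rewrite Sn -ltnS ltn_ord.
have sumE (lam : 'I_n.+1 -> Rdefinitions.R) (j : 'I_n.+1) :
    \sum_(i < n.+1) lam i * (lift1 (lecture_hall_vertices s i) j)%:~R =
    (\sum_(k < j.+1) lam (inord k)) * (S j)%:Z%:~R.
  rewrite (big_ord_widen n.+1 (fun k => lam (inord k))) //.
  rewrite [X in _ = X * _]big_mkcond mulr_suml.
  apply: eq_bigr => i _; rewrite liftE inord_val ltnS.
  by case: ifP; rewrite ?mulr0 ?mul0r.
pose T k : Rdefinitions.R := (y k)%:~R / (S k)%:Z%:~R.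
have linkT k : link S k (y k) (y k.+1) = (0 < T k.+1 - T k < 1).
  have SS : 0 < (S k * S k.+1)%N%:Z%:~R :> Rdefinitions.R.
    by rewrite ltr0z ltz_nat muln_gt0 !S_gt0.
  have DE : (y k.+1 * (S k)%:Z - y k * (S k.+1)%:Z)%:~R =
      (T k.+1 - T k) * (S k * S k.+1)%N%:Z%:~R.
    by rewrite /T PoszM !(rmorphB, rmorphM) /=; field; rewrite !S0.
  rewrite /link; congr (_ && _); rewrite -(ltr_int Rdefinitions.R) DE.
    by rewrite pmulr_lgt0.
  by rewrite -[X in _ < X]mul1r ltr_pM2r.
have T0 : (0 < y 0%N < (S 0%N)%:Z) = (0 < T 0%N < 1).
  have SS : 0 < (S 0%N)%:Z%:~R :> Rdefinitions.R by rewrite ltr0z ltz_nat.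
  by rewrite /T ltr_pdivrMr // mul1r ltr_int pmulr_lgt0 ?invr_gt0 // ltr0z.
split=> [[lam [lam01 xE]]|/chainP[y0 ys]].
  have TE k : (k <= n)%N -> T k = \sum_(i < k.+1) lam (inord i).
    rewrite -ltnS => kn; by rewrite /T /y xE sumE (inordK kn) mulfK.
  apply/chainP; split=> [|k kn].
    by rewrite T0 TE // big_ord1.
  by rewrite linkT !TE // 1?ltnW // big_ord_recr /= addrAC subrr add0r.
exists (fun i : 'I_n.+1 => if val i is k.+1 then T k.+1 - T k else T 0%N); split.
  by case=> -[|k] kn /=; rewrite -?T0 // -linkT ys.
move=> j; rewrite sumE.
suff sumT : forall k, (k <= n)%N -> \sum_(i < k.+1)
    (if val (inord i : 'I_n.+1) is m.+1 then T m.+1 - T m else T 0%N) = T k.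
  by rewrite (sumT j (ltn_ord j)) /T /y inord_val divfK.
elim=> [|k IH] kn; first by rewrite big_ord1 /= inordK.
by rewrite big_ord_recr /= IH ?(ltnW kn) // inordK // addrC subrK.
Qed.

(** The entry 1 at [n] is the scale of the height coordinate. *)
Definition scale (n : nat) (s : 'I_n -> nat) (j : nat) : nat :=
  if insub j is Some i then s i else 1%N.

Lemma scale_gt0 (n : nat) (s : 'I_n -> nat) (j : nat) :
  (forall i, (0 < s i)%N) -> (0 < scale s j)%N.
Proof. by move=> hs; rewrite /scale; case: insub. Qed.

Lemma scale_ord (n : nat) (s : 'I_n -> nat) (j : 'I_n) : scale s j = s j.
Proof. by rewrite /scale valK. Qed.

Lemma scale_n (n : nat) (s : 'I_n -> nat) : scale s n = 1%N.
Proof. by rewrite /scale insubF ?ltnn. Qed.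

(** For [j < n] the vertices 0 to [j] each contribute [s j] to the bound; for [j = n] its summand
    [n.+1] suffices. The grid thus meets the covering hypothesis. *)
Lemma le_par_bound (n : nat) (s : 'I_n -> nat) (j a : nat) :
  (j <= n)%N -> (a < j.+1 * scale s j)%N ->
  (a <= par_bound (lecture_hall_vertices s))%N.
Proof.
rewrite leq_eqVlt => /orP[/eqP->|jn] a_lt.
  by rewrite scale_n muln1 in a_lt; rewrite /par_bound; lia.
apply: leq_trans (ltnW a_lt) (leq_trans _ (leq_addr _ _)).
rewrite -[X in (X * _)%N]card_ord -sum_nat_const.
rewrite (big_ord_widen n.+1 (fun=> scale s j)) ?leqW // big_mkcond leq_sum // => i _.
case: ifP => // ij; rewrite (bigD1 (Ordinal jn)) //= /lecture_hall_vertices /=.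
have {}ij : (i <= j)%N by [].
by rewrite ij absz_nat -scale_ord leq_addr.
Qed.

Lemma box_sumE (n : nat) (s : 'I_n -> nat) (B : nat) :
  (forall i, (0 < s i)%N) ->
  (forall j a, (j <= n)%N -> (a < j.+1 * scale s j)%N -> (a <= B)%N) ->
  \sum_(g : {ffun 'I_n.+1 -> 'I_(B.*2).+1}
        | `[< in_open_par (lecture_hall_vertices s) (grid_pt g) >])
    'X^(absz (grid_pt g ord_max)) = frac_poly (scale s) n 0.
Proof.
move=> hs le_B; have S_gt0 j := scale_gt0 j hs.
pose v (t : 'I_(B.*2).+1) : int := t%:Z - B%:Z.
have v_inj : injective v by move=> t u /addIr[] /ord_inj.
rewrite -(chain_count_fracE v_inj S_gt0) ?scale_n //; last first.
  move=> j a jn /(le_B j a jn) aB.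
  have aB2 : (a + B < (B.*2).+1)%N by lia.
  by exists (Ordinal aB2); rewrite /v /= PoszD addrK.
transitivity (\sum_t 'X^(absz (v t)) *+ chain_count v (scale s) n t : {poly int}).
  rewrite -(sum_chain v (scale s) (fun t => 'X^(absz (v t)))); apply: eq_bigl => g.
  by apply/asboolP/idP => /(in_open_parP (grid_pt g) S_gt0 (scale_ord s) (scale_n s)).
(* The last scale is 1, so every residue is 0 and the quotient is the height itself. *)
by apply: eq_big => t; rewrite ?modn1 ?divn1.
Qed.

Lemma s_derangementE (n : nat) (s : 'I_n -> nat) :
  (forall i, (0 < s i)%N) -> s_derangement s = frac_poly (scale s) n 0.
Proof. by move=> hs; apply: box_sumE => // j a; apply: le_par_bound. Qed.

Lemma s_derangement_coef_ge0 (n : nat) (s : 'I_n -> nat) (k : nat) :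
  0 <= (s_derangement s)`_k.
Proof.
by rewrite coef_sum; apply: sumr_ge0 => g _; rewrite coefXn; case: eqP.
Qed.

Theorem theorem3p6 (n : nat) (s : 'I_n -> nat) (hs : forall i, (0 < s i)%N) :
  real_rooted (s_derangement s) /\ log_concave (s_derangement s) /\
  unimodal (s_derangement s).
Proof.
have rr : real_rooted (s_derangement s).
  by rewrite s_derangementE //; apply: frac_poly_real_rooted => j; apply: scale_gt0.
have lc := pf2_real_rooted (s_derangement_coef_ge0 s) rr.
by split; [|split; [apply: pf2_log_concave | apply: pf2_unimodal]].
Qed.
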